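(* $s_{QA}(m,n,2)=O(m^{7/8})$ for $n=m^{1/8}$ (i.e., sets of size at most $m^{1/8}$ in a universe of size $m$ can be stored in $O(m^{7/8})$ bits so that membership is answered exactly with two adaptive quantum queries).
   Context: Static set membership in the quantum bit-probe model. The universe is $[m]$. A scheme of length $s$ for sets of size at most $n$ consists of a storage map assigning to every $S\subseteq[m]$ with $|S|\le n$ a bit string $b=b(S)\in\{0,1\}^s$, and, for every $x\in[m]$, a quantum query algorithm that accesses $b$ only through the oracle $\mathcal{O}_b:\ket{i}\mapsto(-1)^{b_i}\ket{i}$ ($i\in[s]$), makes at most $t$ oracle queries (adaptively, i.e. in sequence with arbitrary unitaries in between), and outputs with probability $1$ (zero error) the bit $1$ iff $x\in S$. $s_{QA}(m,n,t)$ denotes the minimum length $s$ of such a scheme. Asymptotics are as $m\to\infty$. *)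

(* Defs.v *)
From HB Require Import structures.
From mathcomp Require Import all_boot all_order all_algebra.
From mathcomp Require Import spectral complex mxtens.
From mathcomp Require Import all_classical all_reals all_analysis.

Set Implicit Arguments.
Unset Strict Implicit.
Unset Printing Implicit Defensive.

Import Order.TTheory GRing.Theory Num.Theory.
Import numFieldNormedType.Exports.

Local Open Scope ring_scope.
Local Open Scope complex_scope.

(* The oracle |i>|j> |-> (-1)^(b_i) |i>|j> on C^s (x) C^w: the query register
   has exactly the s basis states |i>, and C^w is a workspace that the oracle
   leaves untouched. *)
Definition oracle (R : realType) (s w : nat) (b : s.-tuple bool) :
    'M[R[i]]_(s * w) :=
  diag_mx (\row_(i < s) (-1) ^+ tnth b i) *t (1%:M : 'M[R[i]]_w).

(* A query algorithm making at most t queries to a string of length s. It starts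
   in a computational basis state and ends with a measurement in the
   computational basis, outputting 1 iff the observed basis state lies in
   qaccept. The memory string is not an argument of any field. *)
Record query_alg (R : realType) (s t : nat) := QueryAlg {
  qwork : nat;
  qcount : nat;
  qcount_le : (qcount <= t)%N;
  qgate : 'I_qcount.+1 -> 'M[R[i]]_(s * qwork);
  qgate_unitary : forall k, qgate k \is unitarymx;
  qinit : 'I_(s * qwork);
  qaccept : {set 'I_(s * qwork)}
}.

Arguments qgate {R s t} q k.

(* State after the first k queries and the gates number 0, ..., k. *)
Fixpoint qstate_at (R : realType) (s t : nat) (A : query_alg R s t)
    (b : s.-tuple bool) (k : nat) : 'cV[R[i]]_(s * qwork A) :=
  match k with
  | 0%N => qgate A (inord 0) *m delta_mx (qinit A) 0
  | k'.+1 => qgate A (inord k'.+1) *m (oracle R (qwork A) b *m qstate_at A b k')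
  end.

Definition qfinal (R : realType) (s t : nat) (A : query_alg R s t)
    (b : s.-tuple bool) : 'cV[R[i]]_(s * qwork A) :=
  qstate_at A b (qcount A).

Definition output_prob (R : realType) (s t : nat) (A : query_alg R s t)
    (b : s.-tuple bool) (o : bool) : R[i] :=
  \sum_(k | (k \in qaccept A) == o) `|qfinal A b k 0| ^+ 2.

(* The values of the storage map on sets with more than n elements are
   irrelevant. *)
Definition has_scheme (R : realType) (m n t s : nat) : Prop :=
  exists (store : {set 'I_m} -> s.-tuple bool)
         (A : 'I_m -> query_alg R s t),
    forall (S : {set 'I_m}) (x : 'I_m), (#|S| <= n)%N ->
      output_prob (A x) (store S) (x \in S) = 1.

(* s = s_QA(m, n, t). The minimum is expressed as a relation because no scheme
   need exist (e.g. for t = 0). *)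
Definition is_s_QA (R : realType) (m n t s : nat) : Prop :=
  has_scheme R m n t s /\ forall s', has_scheme R m n t s' -> (s <= s')%N.

(* Main.v *)
(** Let q be about m^(1/8). The universe is split into q^7 groups of q elements,
    and one bit g(x) is stored per group. Each group x owns 4q cells
    h(x, (c, e, r)) in a table f of 2048 q^7 bits; element r of group x is
    declared a member iff the two cells h(x, (g(x), false, r)) and
    h(x, (g(x), true, r)) have odd parity. A single quantum query computes the
    parity of two bits exactly, so one query reads g(x) (against a cell that is
    always 0) and a second one computes the answer.

    By a union bound some h is almost collision free: every nonempty set T of at
    most 8q groups meets more than 4q|T| - 7|T|/4 cells. Hence:
    - a nonempty set T of at most 8q groups contains a group x and a class c such
      that each pair of cells (x, c, r) has a cell met by no other slot of T;
      removing x and then adjusting these cells solves the parity constraints of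
      T by induction;
    - the set of groups that contain an element of S, enlarged repeatedly by any
      group that already meets its cells twice, has at most 8|S| groups; each
      remaining group has a class none of whose cells is used, and is given that
      class. *)

Require Import Defs.
From HB Require Import structures.
From mathcomp Require Import all_boot all_order all_algebra.
From mathcomp Require Import fingroup perm spectral complex mxtens.
From mathcomp Require Import all_classical all_reals all_analysis.
(* Imported after all_classical so that setP, subsetP, bigcupP, ... are those of
   finite sets. *)
From mathcomp Require Import fintype bigop finset.
From mathcomp Require Import zify ring lra.

Set Implicit Arguments.
Unset Strict Implicit.
Unset Printing Implicit Defensive.

Import Order.TTheory GRing.Theory Num.Theory.
Import numFieldNormedType.Exports.

(** * Counting maps with collisions *)

Lemma card_bigcup_le (I X : finType) (P : pred I) (F : I -> {set X}) :
  #|\bigcup_(i | P i) F i| <= \sum_(i | P i) #|F i|.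
Proof.
elim/big_rec2: _ => [|i c A _ IH]; first by rewrite cards0.
by rewrite (leq_trans (leq_card_setU _ _)) // leq_add2l.
Qed.

(** Since [rho] sends [B] outside [B], such an [h] is determined by its values off [B]. *)
Lemma card_factoring_le (X Y : finType) (y0 : Y) (B : {set X})
    (rho : {ffun X -> X}) :
  #|[set h : {ffun X -> Y}
      | [forall x in B, (rho x \notin B) && (h x == h (rho x))]]|
    <= #|Y| ^ (#|X| - #|B|).
Proof.
pose restr (h : {ffun X -> Y}) := [ffun x => if x \in B then y0 else h x].
rewrite -(@card_in_imset _ _ restr); last first.
  move=> h1 h2; rewrite !inE => /forall_inP H1 /forall_inP H2 /ffunP E.
  have E' x : x \notin B -> h1 x = h2 x.
    by move=> /negbTE xB; have := E x; rewrite !ffunE xB.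
  apply/ffunP => x; have [xB|/E' //] := boolP (x \in B).
  have /andP[nB /eqP->] := H1 _ xB; have /andP[_ /eqP->] := H2 _ xB.
  exact: E'.
rewrite (_ : #|X| - #|B| = #|~: B|); last by rewrite [RHS]cardsCs setCK.
rewrite -(card_pffun_on y0).
apply/subset_leq_card/subsetP => _ /imsetP[h _ ->].
apply/pffun_onP; split => //; apply/fintype.subsetP => x.
by rewrite !inE ffunE; case: (x \in B); rewrite ?eqxx.
Qed.

(* A map that loses d values on A repeats, at d points of A, values that it
   takes at other points of A; these d values are determined by the choice of
   the points. *)
Lemma card_collapsing_le (X Y : finType) (y0 : Y) (A : {set X}) (d : nat) :
  #|[set h : {ffun X -> Y} | #|h @: A| + d <= #|A|]|
    <= 'C(#|A|, d) * #|A| ^ d * #|Y| ^ (#|X| - d).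
Proof.
case: d => [|d].
  by rewrite bin0 !mul1n subn0 -card_ffun max_card.
have [->|[x0 x0A]] := set_0Vmem A.
  apply: leq_trans (leq0n _); rewrite leqn0 cards_eq0.
  by apply/eqP/setP => h; rewrite !inE imset0 !cards0.
pose E (B : {set X}) (rho : {ffun X -> X}) := [set h : {ffun X -> Y}
  | [forall x in B, (rho x \notin B) && (h x == h (rho x))]].
pose U := \bigcup_(B in [set B : {set X} | B \subset A & #|B| == d.+1])
            \bigcup_(rho : {ffun X -> X} | rho \in pffun_on x0 B A) E B rho.
apply: (@leq_trans #|U|).
  apply/subset_leq_card/subsetP => h; rewrite inE => hd.
  (* [r x] represents in [A] the fibre of [h] through [x]. It depends on [h x] only, so [h] is
     injective on the set [C] of representatives. *)
  pose r x := odflt x [pick z in A | h z == h x].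
  have rP x : x \in A -> r x \in A /\ h (r x) = h x.
    move=> xA; rewrite /r; case: pickP => [z /andP[zA /eqP]|] //=.
  have r_h x z : x \in A -> z \in A -> h x = h z -> r x = r z.
    move=> xA zA xz; rewrite /r xz.
    by case: pickP => // /(_ z); rewrite zA eqxx.
  pose C := r @: A.
  have CA : C \subset A by apply/subsetP => _ /imsetP[x xA ->]; case: (rP x xA).
  have cC : #|C| = #|h @: A|.
    rewrite -(@card_in_imset _ _ h (mem C)).
      congr #|pred_of_set _|; apply/setP => y; apply/imsetP/imsetP.
        by case=> _ /imsetP[x xA ->] ->; exists x => //; case: (rP x xA).
      case=> x xA ->; exists (r x); first exact: imset_f.
      by case: (rP x xA).
    move=> _ _ /imsetP[x xA ->] /imsetP[z zA ->].
    by case: (rP x xA) => _ ->; case: (rP z zA) => _ -> /r_h ->.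
  (* Any [d.+1] points of [A] that are not representatives can serve as [B], with [r] as [rho]. *)
  have dAC : d.+1 <= #|A :\: C| by rewrite cardsDS // cC; lia.
  have [B BAC cB] : exists2 B : {set X}, B \subset A :\: C & #|B| = d.+1.
    have : 0 < #|[set B : {set X} | B \subset A :\: C & #|B| == d.+1]|.
      by rewrite cards_draws bin_gt0.
    by case/card_gt0P => B; rewrite inE => /andP[? /eqP]; exists B.
  have BA : B \subset A by rewrite (subset_trans BAC) // subsetDl.
  apply/bigcupP; exists B; first by rewrite inE BA cB eqxx.
  apply/bigcupP; exists [ffun x => if x \in B then r x else x0].
    apply/pffun_onP; split; first apply/fintype.subsetP => x.
      by rewrite !inE ffunE; case: (x \in B); rewrite ?eqxx.
    move=> _ /imageP[x xB ->]; rewrite ffunE xB.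
    by case: (rP x (subsetP BA _ xB)).
  rewrite inE; apply/forall_inP => x xB; rewrite ffunE xB.
  have [_ ->] := rP x (subsetP BA _ xB); rewrite eqxx andbT.
  apply/negP => /(subsetP BAC); rewrite inE => /andP[/negP[]].
  by rewrite imset_f // (subsetP BA).
apply: leq_trans (card_bigcup_le _ _) _.
rewrite -cards_draws -mulnA -sum_nat_const; apply: leq_sum => B.
rewrite inE => /andP[_ /eqP cB].
apply: leq_trans (card_bigcup_le _ _) _.
rewrite -cB -(card_pffun_on x0) -sum_nat_const; apply: leq_sum => rho _.
exact: card_factoring_le.
Qed.

Lemma bin_le_exp2 n m : 'C(n, m) <= 2 ^ n.
Proof.
elim: n m => [|n IHn] [|m]; rewrite ?bin0 ?expn_gt0 // binS expnS mul2n -addnn.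
exact: leq_add.
Qed.

Lemma ffact_le_exp n m : n ^_ m <= n ^ m.
Proof.
have -> : n ^ m = \prod_(i < m) n by rewrite prod_nat_const card_ord.
by rewrite ffact_prod; apply: leq_prod => i _; exact: leq_subr.
Qed.

Lemma exp_le_ffact n m : (n - m) ^ m <= n ^_ m.
Proof.
have -> : (n - m) ^ m = \prod_(i < m) (n - m).
  by rewrite prod_nat_const card_ord.
by rewrite ffact_prod; apply: leq_prod => i _; rewrite leq_sub2l // ltnW.
Qed.

(** d^d <= 2d (2d-1) ... (d+1) = C(2d,d) d!, and the binomial coefficient is at most 4^d. *)
Lemma selfexp_le_fact d : d ^ d <= 4 ^ d * d`!.
Proof.
rewrite -{1}(addnK d d) addnn -mul2n.
rewrite (leq_trans (exp_le_ffact _ _)) // -bin_ffact leq_mul2r.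
by rewrite -[4]/(2 ^ 2) -expnM bin_le_exp2 orbT.
Qed.

Lemma sum_geometric_lt (N M : nat) (W : nat -> nat) :
  0 < M -> (forall j, 0 < j <= N -> 2 ^ j * W j <= M) ->
  \sum_(1 <= j < N.+1) W j < M.
Proof.
move=> M0 WM.
(* Division-free form of: the partial sum up to [n] is at most M (1 - 2^-n). *)
have H : forall n, n <= N -> 2 ^ n * (\sum_(1 <= j < n.+1) W j) + M <= 2 ^ n * M.
  elim=> [|n IHn] nN; first by rewrite big_geq // muln0 mul1n.
  rewrite big_nat_recr //= mulnDr; have := WM n.+1 nN.
  by have := IHn (ltnW nN); rewrite expnS; nia.
by have := H N (leqnn N); rewrite -(ltn_pmul2l (expn_gt0 2 N)); lia.
Qed.

(** * Existence of an almost collision-free map *)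

Definition nbhd (G L V : finType) (h : G * L -> V) (T : {set G}) : {set V} :=
  h @: setX T [set: L].

(** A loss below 7/4 values per group, cleared of denominators. Being less than 2, it yields free
    classes; 7/4 = 2 * 7/8 keeps the enlargement within eight times the initial size; and a loss d
    >= 7j/4 pays for the choice of j groups, as q^(7j) <= q^(4d). *)
Definition lossless (G L V : finType) (h : G * L -> V) (N : nat) : Prop :=
  forall T : {set G}, 0 < #|T| <= N ->
    4 * (#|T| * #|L|) < 4 * #|nbhd h T| + 7 * #|T|.

(** Source of the constant 2048. Put D = 4qj and multiply by d^d. Then C(D,d) d! <= D^d and d^d <=
    4^d d! reduce the claim to 16 q^4 D^2 <= 2048 q^7 d, where D^2 = 16 q^2 j^2, j <= 8q and j <=
    d. *)
Lemma collapse_bound (q j d : nat) :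
  j <= 8 * q -> 7 * j <= 4 * d -> 0 < d -> 0 < q ->
  'C(j * (4 * q), d) * (j * (4 * q)) ^ d * (4 * q ^ 7) ^ j <= (2048 * q ^ 7) ^ d.
Proof.
move=> jq jd d0 q0; set D := j * (4 * q).
rewrite -(@leq_pmul2r (d ^ d)) ?expn_gt0 ?d0 //.
have le1 : (4 * q ^ 7) ^ j <= (4 * q ^ 4) ^ d.
  rewrite (expnMn 4 (q ^ 7)) (expnMn 4 (q ^ 4)) -!expnM.
  by rewrite leq_mul // leq_pexp2l //; lia.
apply: (@leq_trans ('C(D, d) * D ^ d * (4 * q ^ 4) ^ d * (4 ^ d * d`!))).
  by rewrite leq_mul ?selfexp_le_fact // leq_mul.
apply: (@leq_trans ((D * (D * (4 * q ^ 4) * 4)) ^ d)).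
  rewrite (expnMn D) (expnMn (D * _)) (expnMn D).
  have := ffact_le_exp D d; rewrite -bin_ffact => le2.
  rewrite [leqLHS](_ : _ = 'C(D, d) * d`! * (D ^ d * (4 * q ^ 4) ^ d * 4 ^ d)).
    by rewrite leq_mul2r le2 orbT.
  by move: ('C(D, d)) (D ^ d) ((4 * _) ^ d) (4 ^ d) (d`!) => *; ring.
rewrite -expnMn leq_exp2r //.
rewrite (_ : D * _ = 256 * q ^ 6 * (j * j)); last first.
  by rewrite /D !expnS; ring.
apply: (@leq_trans (256 * q ^ 6 * (j * (8 * q)))); first by rewrite !leq_mul2l jq !orbT.
rewrite (_ : _ * (j * (8 * q)) = 2048 * q ^ 7 * j); last by rewrite !expnS; ring.
by rewrite leq_mul2l; apply/orP; right; lia.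
Qed.

Lemma exists_lossless (G L V : finType) (q : nat) :
  0 < q -> #|G| = q ^ 7 -> #|L| = 4 * q -> #|V| = 2048 * q ^ 7 ->
  exists h : {ffun G * L -> V}, lossless h (8 * q).
Proof.
move=> q0 cG cL cV.
have V0 : 0 < #|V| by rewrite cV muln_gt0 expn_gt0 q0.
have [v0 _] := card_gt0P V0.
(* The ceiling of 7j/4: by integrality, a set [T] that violates losslessness loses at least this
   many values for j = [#|T|]. *)
pose d j := (7 * j + 3) %/ 4.
pose bad (T : {set G}) := [set h : {ffun G * L -> V}
  | #|h @: setX T [set: L]| + d #|T| <= #|setX T [set: L]|].
pose P (T : {set G}) := 0 < #|T| <= 8 * q.
pose M := #|V| ^ #|{: G * L}|.
have badM T : P T -> #|bad T| * (4 * q ^ 7) ^ #|T| <= M.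
  move=> /andP[T0 Tq]; set j := #|T|.
  have cA : #|setX T [set: L]| = j * (4 * q) by rewrite cardsX cardsT cL.
  have dA : d j <= #|{: G * L}|.
    have : j <= #|G| by exact: max_card.
    rewrite card_prod cL /d => jG.
    apply: (@leq_trans (j * (4 * q))); last by rewrite leq_mul2r jG orbT.
    by rewrite /j in T0 *; nia.
  apply: leq_trans (leq_mul (card_collapsing_le v0 _ _) (leqnn _)) _.
  rewrite cA mulnAC /M -[X in _ <= _ ^ X](subnK dA) expnD mulnC.
  rewrite leq_mul2l; apply/orP; right; rewrite cV.
  by apply: collapse_bound => //; rewrite /j in T0 *; rewrite /d; lia.
case: (boolP [exists h : {ffun G * L -> V}, [forall T : {set G},
         P T ==> (4 * (#|T| * #|L|) < 4 * #|nbhd h T| + 7 * #|T|)]]).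
  case/existsP => h /forallP H; exists h => T PT.
  by have /implyP := H T; apply.
rewrite negb_exists => /forallP none; exfalso.
have sub : [set: {ffun G * L -> V}] \subset \bigcup_(T | P T) bad T.
  apply/subsetP => h _; have := none h; rewrite negb_forall => /existsP[T].
  rewrite negb_imply -leqNgt => /andP[PT le]; apply/bigcupP; exists T => //.
  rewrite inE cardsX cardsT -/(nbhd h T) /d.
  by move: (#|T| * #|L|) le => x; move: #|nbhd h T| #|T| => y z; lia.
have := leq_trans (subset_leq_card sub) (card_bigcup_le _ _).
rewrite cardsT card_ffun -/M leqNgt => /negP; apply.
(* At most (q^7)^j sets have size j, and [badM] leaves a factor 2^j to spare, so W j <= M / 2^j. *)
pose W j := \sum_(T : {set G} | #|T| == j) #|bad T|.
rewrite (_ : \sum_(T | P T) _ = \sum_(1 <= j < (8 * q).+1) W j).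
  apply: sum_geometric_lt => [|j jq]; first by rewrite expn_gt0 V0.
  rewrite -(@leq_pmul2r ((q ^ 7) ^ j)) ?expn_gt0 ?q0 //.
  apply: (@leq_trans (\sum_(T : {set G} | #|T| == j) M)).
    rewrite mulnAC -expnMn /W big_distrr /=; apply: leq_sum => T /eqP Tj.
    have := badM T; rewrite /P Tj => /(_ jq); apply: leq_trans.
    rewrite mulnC leq_mul2l; apply/orP; right.
    by case/andP: jq => j0 _; rewrite leq_exp2r // leq_mul2r orbT.
  rewrite sum_nat_const mulnC leq_mul2l; apply/orP; right.
  rewrite -cardsE card_draws cG (leq_trans _ (ffact_le_exp _ _)) //.
  by rewrite -bin_ffact leq_pmulr // fact_gt0.
have [N EN] : exists N, 8 * q = N.+1 by exists (8 * q).-1; lia.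
rewrite /W big_add1 /= big_mkord /P EN.
rewrite (partition_big (fun T : {set G} => inord #|T|.-1 : 'I_N.+1) predT) //=.
apply: eq_bigr => i _; apply: eq_bigl => T; apply/idP/idP.
  by case/andP=> /andP[T0 Tq] /eqP <-; rewrite inordK; lia.
move=> /eqP E; rewrite E /= (ltn_ord i) /=.
by apply/eqP/val_inj; rewrite /= inordK.
Qed.

(** * Storing a set in an almost collision-free table *)

Definition shared (X V : finType) (h : X -> V) (A : {set X}) (x : X) : bool :=
  [exists y in A, (y != x) && (h y == h x)].

(** Each value taken at a shared point has at least two shared preimages, so the shared points yield
    at most half as many values as their number. *)
Lemma card_imset_shared (X V : finType) (h : X -> V) (A : {set X}) :
  2 * #|h @: A| + #|[set x in A | shared h A x]| <= 2 * #|A|.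
Proof.
set Sh := [set x in A | _].
have SA : Sh \subset A by apply/subsetP => x; rewrite inE => /andP[].
have le1 : #|h @: A| <= #|A :\: Sh| + #|h @: Sh|.
  rewrite -{1}(setID A Sh) (setIidPr SA) setUC imsetU.
  by rewrite (leq_trans (leq_card_setU _ _)) // leq_add2r leq_imset_card.
have le2 : 2 * #|h @: Sh| <= #|Sh|.
  rewrite -[leqRHS]sum1_card (partition_big_imset h) /= mulnC -sum_nat_const.
  apply: leq_sum => _ /imsetP[x xS ->].
  move: (xS); rewrite inE => /andP[xA /exists_inP[y yA /andP[yx /eqP hyx]]].
  have yS : y \in Sh.
    rewrite inE yA; apply/exists_inP; exists x => //.
    by rewrite eq_sym yx hyx eqxx.
  rewrite sum1dep_card -(_ : #|[set x; y]| = 2); last by rewrite cards2 eq_sym yx.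
  apply/subset_leq_card/subsetP => z; rewrite in_set2 inE.
  by case/orP => /eqP->; rewrite ?xS ?yS ?hyx eqxx.
have := subset_leq_card SA; move: le1; rewrite cardsDS //; lia.
Qed.

Section Lossless.
Variables (G V : finType) (k : nat).
Variable h : G * (bool * bool * 'I_k) -> V.

Lemma card_bool2_ord : #|{: bool * bool * 'I_k}| = 4 * k.
Proof. by rewrite !card_prod card_bool card_ord. Qed.

(** Otherwise every group of [T] has, in either class, a position with both cells shared. These 4
    [#|T|] shared slots lose at least 2 [#|T|] values, more than losslessness permits. *)
Lemma lossless_free_class (N : nat) (T : {set G}) :
  lossless h N -> 0 < #|T| <= N ->
  exists2 x, x \in T & exists c, forall r, exists e,
    ~~ shared h (setX T setT) (x, (c, e, r)).
Proof.
move=> hN TN; set A := setX T setT.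
case: (boolP [exists x in T, [exists c, [forall r, [exists e,
         ~~ shared h A (x, (c, e, r))]]]]).
  case/exists_inP => x xT /existsP[c /forallP H].
  by exists x => //; exists c => r; apply/existsP.
rewrite negb_exists_in => /forall_inP none; exfalso.
have sh x c : x \in T -> exists r, forall e, shared h A (x, (c, e, r)).
  move=> /none; rewrite negb_exists => /forallP/(_ c).
  rewrite negb_forall => /existsP[r]; rewrite negb_exists => /forallP H.
  by exists r => e; have := H e; rewrite negbK.
have [/eqP T0|[x0 x0T]] := set_0Vmem T; first by case/andP: TN; rewrite -cards_eq0 in T0; rewrite (eqP T0).
have [r0 _] := sh x0 true x0T.
pose rr x c := odflt r0 [pick r | [forall e, shared h A (x, (c, e, r))]].
have rrP x c e : x \in T -> shared h A (x, (c, e, rr x c)).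
  move=> xT; rewrite /rr; case: pickP => [r /forallP //|/=].
  have [r H] := sh x c xT; move=> /(_ r)/negbT/negP[].
  by apply/forallP.
(* Keeping [x], [c] and [e] in the image makes [phi] injective. *)
pose phi (p : G * (bool * bool)) := (p.1, (p.2.1, p.2.2, rr p.1 p.2.1)).
have le : #|T| * 4 <= #|[set x in A | shared h A x]|.
  have -> : #|T| * 4 = #|phi @: setX T setT|.
    rewrite card_imset; last by move=> [x [c e]] [x' [c' e']] [-> -> ->].
    by rewrite cardsX cardsT card_prod card_bool.
  apply/subset_leq_card/subsetP => _ /imsetP[[x [c e]] + ->].
  by rewrite !inE /= andbT => xT; rewrite xT rrP.
have := hN T TN; have := leq_add (card_imset_shared h A) le.
rewrite -/(nbhd h T) [#|A|]cardsX cardsT.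
by move: (#|T| * #|{: _ * _}|) => x; move: #|nbhd h T| #|T| #|_| => *; lia.
Qed.

(** The support condition on [f] later lets groups outside [T] read zeros in an untouched class. *)
Lemma lossless_solve (N : nat) (T : {set G}) (val : G -> 'I_k -> bool) :
  lossless h N -> #|T| <= N ->
  exists f : V -> bool, exists g : G -> bool,
    (forall v, f v -> v \in nbhd h T) /\
    (forall x r, x \in T ->
       f (h (x, (g x, false, r))) (+) f (h (x, (g x, true, r))) = val x r).
Proof.
move=> hN; have [n] := ubnP #|T|; elim: n T => // n IHn T Tn TN.
have [->|[x1 x1T]] := set_0Vmem T.
  by exists (fun=> false), (fun=> false); split => // x r; rewrite inE.
have [|x xT [c free]] := lossless_free_class hN (T := T).
  by rewrite TN andbT; apply/card_gt0P; exists x1.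
have cT : #|T| = #|T :\ x|.+1 by rewrite (cardsD1 x) xT.
have [||f [g [fN fg]]] := IHn (T :\ x); [by lia..|].
pose A := setX T [set: bool * bool * 'I_k].
(* [e r] selects an end whose cell is unshared, namely [true] exactly when the [false] end is
   shared. [w r] is this private cell, met by no other slot of [T]. *)
pose e r := shared h A (x, (c, false, r)).
pose w r := h (x, (c, e r, r)).
have wP y r : y.1 \in T -> h y = w r -> y = (x, (c, e r, r)).
  move=> yT hy; apply/eqP/negPn/negP => ny.
  have sh : shared h A (x, (c, e r, r)).
    by apply/exists_inP; exists y; [rewrite !inE yT|rewrite ny hy eqxx].
  have [e0 /negP[]] := free r; move: sh; rewrite /e.
  by case E : (shared h A (x, (c, false, r))) => sh; [case: e0|rewrite E in sh].
have w_inj : injective w.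
  by move=> r r' E; have /= := wP (x, (c, e r, r)) r' xT E; case.
have nw y : y.1 \in T :\ x -> forall r, w r != h y.
  rewrite !inE => /andP[yx yT] r; apply/eqP => /esym/(wP _ _ yT) E.
  by rewrite E eqxx in yx.
have now r r' : w r' != h (x, (c, ~~ e r, r)).
  apply/eqP => /esym/(wP (_, _)) /= /(_ xT) [H rr].
  by rewrite rr in H; case: (e r') H.
(* A private cell receives the required parity plus the value of its partner. By [now] the partner
   is not a private cell of [x], so it keeps its value under [f]. *)
pose f1 v := if [pick r | w r == v] is Some r
             then val x r (+) f (h (x, (c, ~~ e r, r))) else f v.
have f1w r : f1 (w r) = val x r (+) f (h (x, (c, ~~ e r, r))).
  rewrite /f1; case: pickP => [r' /eqP/w_inj -> //|/(_ r)].
  by rewrite eqxx.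
have f1n v : (forall r, w r != v) -> f1 v = f v.
  by move=> nwv; rewrite /f1; case: pickP => // r; rewrite (negbTE (nwv r)).
exists f1, (fun y => if y == x then c else g y); split.
  move=> v; rewrite /f1; case: pickP => [r /eqP <- _|_ /fN].
    by apply: imset_f; rewrite !inE xT.
  case/imsetP => y; rewrite !inE andbT => /andP[_ yT] ->.
  by apply: imset_f; rewrite !inE yT.
move=> y r yT; case: eqP => [->|/eqP yx]; last first.
  have yT' : y \in T :\ x by rewrite !inE yx.
  by rewrite !f1n ?fg //; apply: nw.
have := f1w r; have := f1n _ (now r); rewrite /w; case: (e r) => /= -> ->.
  by rewrite addbCA addbb addbF.
by rewrite -addbA addbb addbF.
Qed.

(* T0 is enlarged by groups with two cells in nbhd h T. Each such group costs two
   collisions, while a set of size 8 * #|T0| has fewer than 14 * #|T0|. *)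
Lemma lossless_store (n : nat) (val : G -> 'I_k -> bool) :
  lossless h (8 * n) -> #|[set x | [exists r, val x r]]| <= n ->
  exists f : V -> bool, exists g : G -> bool,
    forall x r, f (h (x, (g x, false, r))) (+) f (h (x, (g x, true, r))) = val x r.
Proof.
move=> hn; set T0 := [set x | _] => T0n.
have [l lE] : {l | #|{: bool * bool * 'I_k}| = l} by eexists.
pose P (T : {set G}) := [&& T0 \subset T, #|T| <= 8 * #|T0| &
  #|nbhd h T| + 2 * (#|T| - #|T0|) <= #|T| * l].
have PT0 : P T0.
  rewrite /P subxx subnn muln0 addn0 leq_pmull //=.
  by rewrite (leq_trans (leq_imset_card _ _)) // cardsX cardsT lE.
have [T /and3P[T0T Tle NT] Tmax] := arg_maxnP (fun T : {set G} => #|T|) PT0.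
have TN : #|T| <= 8 * n by apply: leq_trans Tle _; rewrite leq_mul2l T0n.
(* If both classes of [x] met [nbhd h T], the two slots concerned would be distinct, and [x] could
   be added to the maximal [T]. *)
have cold x : x \notin T -> exists c, forall e r, h (x, (c, e, r)) \notin nbhd h T.
  move=> xT; case: (boolP [exists c, [forall e, [forall r,
                      h (x, (c, e, r)) \notin nbhd h T]]]).
    by case/existsP => c /forallP H; exists c => e r; have /forallP := H e.
  rewrite negb_exists => /forallP H; exfalso.
  have touch c : exists s : bool * bool * 'I_k, s.1.1 = c /\ h (x, s) \in nbhd h T.
    have := H c; rewrite negb_forall => /existsP[e].
    by rewrite negb_forall => /existsP[r]; rewrite negbK; exists (c, e, r).
  have [[s0 [c0 s0N]] [s1 [c1 s1N]]] := (touch false, touch true).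
  have s01 : s0 != s1 by apply: contraTneq isT => s01; rewrite s01 c1 in c0.
  have T0' : 0 < #|T0|.
    case/imsetP: s0N => y; rewrite !inE andbT => yT _.
    have : 0 < #|T| by apply/card_gt0P; exists y.1.
    by move: Tle; lia.
  have Tlt : #|T| < 8 * #|T0|.
    rewrite ltnNge; apply/negP => Tge.
    have := hn T; rewrite TN andbT => /(_ ltac:(lia)).
    by rewrite lE; move: (#|T| * l) NT => Tl; lia.
  have cT1 : #|x |: T| = #|T|.+1 by rewrite cardsU1 xT.
  have NT1 : #|nbhd h (x |: T)| + 2 <= #|nbhd h T| + l.
    have sub : nbhd h (x |: T) \subset
        nbhd h T :|: (fun s => h (x, s)) @: ~: [set s0; s1].
      apply/subsetP => _ /imsetP[[y s] + ->].
      rewrite !inE andbT /= => /orP[/eqP->|yT]; last first.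
        by rewrite imset_f // !inE yT.
      have [-> |n0] := eqVneq s s0; first by rewrite s0N.
      have [-> |n1] := eqVneq s s1; first by rewrite s1N.
      by apply/orP; right; apply/imset_f; rewrite !inE negb_or n0.
    have <- : #|~: [set s0; s1]| + 2 = l.
      by rewrite -lE -(cardsC [set s0; s1]) cards2 s01 addnC.
    rewrite addnA leq_add2r (leq_trans (subset_leq_card sub)) //.
    by rewrite (leq_trans (leq_card_setU _ _)) // leq_add2l leq_imset_card.
  suff /Tmax : P (x |: T) by rewrite /= cT1 ltnn.
  rewrite /P cT1 Tlt (subset_trans T0T) ?subsetUr //=.
  rewrite (mulSn #|T|) subSn ?subset_leq_card // mulnS.
  rewrite addnA (leq_trans (leq_add NT1 (leqnn _))) //.
  by rewrite addnAC addnC leq_add2l.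
have [f [g [fN fg]]] := lossless_solve val hn TN.
(* Outside [T], class [true] is taken if untouched; otherwise [cold] makes class [false] untouched.
   Both cells then hold 0, as required off [T0]. *)
pose g' x := if x \in T then g x else
  [forall e, [forall r, h (x, (true, e, r)) \notin nbhd h T]].
exists f, g' => x r; rewrite /g'; case: ifPn => [xT|xT]; first exact: fg.
have f0 c e : (forall e r, h (x, (c, e, r)) \notin nbhd h T) ->
    f (h (x, (c, e, r))) = false.
  by move=> /(_ e r); apply: contraNF => /fN.
have -> : val x r = false.
  apply: contraNF xT => vx; apply: (subsetP T0T).
  by rewrite inE; apply/existsP; exists r.
case: (boolP [forall e, [forall r, h (x, (true, e, r)) \notin nbhd h T]])
    => [/forallP H|H].
  by rewrite !f0 // => e r'; have /forallP := H e.
have [[] H'] := cold x xT; last by rewrite !f0.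
by case/negP: H; apply/forallP => e; apply/forallP => r'.
Qed.

End Lossless.

(** * Parities of two bits with one exact query *)

Local Open Scope ring_scope.

(* The Hadamard gate on the plane spanned by the basis states a and b. *)
HB.lock Definition hadamard (C : numClosedFieldType) (N : nat) (a b : 'I_N) :
    'M[C]_N :=
  1%:M - (delta_mx a a + delta_mx b b)
  + (sqrtC 2)^-1 *: (delta_mx a a + delta_mx a b + delta_mx b a - delta_mx b b).

Section Gates.
Variables (C : numClosedFieldType) (N : nat).
Local Notation hadamard := (hadamard C).
Implicit Types a b x : 'I_N.

Let h : C := (sqrtC 2)^-1.

Lemma invsqrt2_sqr : h * h *+ 2 = 1.
Proof.
rewrite -invfM -expr2 sqrtCK -mulr_natl mulfV // pnatr_eq0.
Qed.

Lemma mul_delta_col x y a :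
  delta_mx x y *m delta_mx a 0 = (y == a)%:R *: (delta_mx x 0 : 'cV[C]_N).
Proof.
by rewrite mul_delta_mx_cond; case: eqP; rewrite ?mulr1n ?mulr0n ?scale1r ?scale0r.
Qed.

Lemma hadamard_left a b : a != b ->
  hadamard a b *m delta_mx a 0
    = h *: (delta_mx a 0 + delta_mx b 0) :> 'cV[C]_N.
Proof.
move=> ab; rewrite hadamard.unlock mulmxDl mulmxBl -scalemxAl mulmxBl !mulmxDl mul1mx.
rewrite !mul_delta_col eqxx eq_sym (negbTE ab) !scale0r !scale1r !addr0 subr0.
by rewrite subrr add0r.
Qed.

Lemma hadamard_right a b : a != b ->
  hadamard a b *m delta_mx b 0
    = h *: (delta_mx a 0 - delta_mx b 0) :> 'cV[C]_N.
Proof.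
move=> ab; rewrite hadamard.unlock mulmxDl mulmxBl -scalemxAl mulmxBl !mulmxDl mul1mx.
rewrite !mul_delta_col eqxx (negbTE ab) !scale0r !scale1r !addr0 !add0r.
by rewrite subrr add0r.
Qed.

Lemma hadamard_other a b x : a != x -> b != x ->
  hadamard a b *m delta_mx x 0 = delta_mx x 0 :> 'cV[C]_N.
Proof.
move=> ax bx; rewrite hadamard.unlock mulmxDl mulmxBl -scalemxAl mulmxBl !mulmxDl mul1mx.
by rewrite !mul_delta_col (negbTE ax) (negbTE bx) !scale0r !addr0 !subr0 scaler0 addr0.
Qed.

Lemma eq_mulmx_delta (A B : 'M[C]_N) :
  (forall x, A *m delta_mx x 0 = B *m delta_mx x 0 :> 'cV[C]_N) -> A = B.
Proof.
by move=> AB; apply/matrixP => i j; have /colP/(_ i) := AB j; rewrite -!colE !mxE.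
Qed.

(** Interference: one branch cancels and the other gets amplitude 1, so the relative sign left by a
    query becomes a basis state with certainty. *)
Lemma hadamard_phase a b (e : bool) : a != b ->
  hadamard a b *m (h *: (delta_mx a 0 + (-1) ^+ e *: delta_mx b 0))
    = delta_mx (if e then b else a) 0 :> 'cV[C]_N.
Proof.
move=> ab; rewrite -scalemxAr mulmxDr -scalemxAr hadamard_left // hadamard_right //.
have two (v : 'cV[C]_N) : (h * h) *: (v + v) = v.
  by rewrite -mulr2n -scalerMnr scalerMnl invsqrt2_sqr scale1r.
case: e; rewrite /= ?expr1 ?expr0 ?scaleN1r ?scale1r -?scalerBr -?scalerDr scalerA.
  by rewrite opprD opprK addrACA subrr add0r.
by rewrite addrACA subrr addr0.
Qed.

(** The matrix is real symmetric, and it is an involution on basis vectors. *)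
Lemma hadamard_unitary a b : a != b -> hadamard a b \is unitarymx.
Proof.
move=> ab; apply/unitarymxP.
have -> : map_mx Num.conj (hadamard a b)^T = hadamard a b.
  have hc : Num.conj h = h.
    by apply: geC0_conj; rewrite invr_ge0 sqrtC_ge0 ler0n.
  rewrite hadamard.unlock; apply/matrixP => i j; rewrite !mxE.
  rewrite !(rmorphB, rmorphD, rmorphM, rmorph_nat) /= hc.
  rewrite eq_sym ![(j == _) && _]andbC; congr (_ + _ * _).
  by rewrite -!addrA; congr (_ + _); rewrite addrCA.
apply: eq_mulmx_delta => x; rewrite -mulmxA mul1mx.
have [<-|ax] := eqVneq a x.
  by rewrite hadamard_left // -[delta_mx b 0]scale1r -(expr0 (-1)) (hadamard_phase false).
have [<-|bx] := eqVneq b x.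
  by rewrite hadamard_right // -scaleN1r -(expr1 (-1)) (hadamard_phase true).
by rewrite !hadamard_other.
Qed.

Lemma perm_mx_unitary (s : 'S_N) : perm_mx s \is unitarymx (C:=C).
Proof.
apply/unitarymxP; rewrite tr_perm_mx map_perm_mx -perm_mxM.
by rewrite mulgV perm_mx1.
Qed.

Lemma tperm_mx_delta a b x :
  (perm_mx (tperm a b) : 'M[C]_N) *m delta_mx x 0
    = delta_mx (tperm a b x) 0 :> 'cV[C]_N.
Proof.
rewrite -row_permE; apply/matrixP => i j; rewrite !mxE.
by rewrite (can2_eq (tpermK a b) (tpermK a b)).
Qed.

End Gates.

(** * The two-query algorithm *)

Section TwoQueries.
Variables (R : realType) (s : nat).

Lemma oracle_delta (w : nat) (b : s.-tuple bool) (i : 'I_s) (j : 'I_w) :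
  oracle R w b *m delta_mx (mxtens_index (i, j)) 0
    = (-1) ^+ tnth b i *: delta_mx (mxtens_index (i, j)) 0 :> 'cV[R[i]]_(s * w).
Proof.
rewrite -colE; apply/colP => x; case: (mxtens_indexP x) => i' j'.
rewrite [LHS]mxE /oracle tensmxE !mxE eqxx andbT.
rewrite (can_eq (@mxtens_indexK _ _)) xpair_eqE.
have [->|_] := eqVneq i' i; case: (j' == j);
  by rewrite ?mulr1n ?mulr0n ?mulr1 ?mulr0 ?mul0r.
Qed.

(** The sign of the first bit becomes a global phase; the parity remains as the relative sign. *)
Lemma oracle_pair (w : nat) (b : s.-tuple bool) (i i' : 'I_s) (j j' : 'I_w) (c : R[i]) :
  oracle R w b *m (c *: (delta_mx (mxtens_index (i, j)) 0
                         + delta_mx (mxtens_index (i', j')) 0))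
    = (-1) ^+ tnth b i *: (c *: (delta_mx (mxtens_index (i, j)) 0
        + (-1) ^+ (tnth b i (+) tnth b i') *: delta_mx (mxtens_index (i', j')) 0))
    :> 'cV[R[i]]_(s * w).
Proof.
rewrite -scalemxAr mulmxDr !oracle_delta [RHS]scalerA [_ * c]mulrC -[RHS]scalerA.
congr (c *: _); rewrite scalerDr; congr (_ + _).
by rewrite signr_addb scalerA mulrA -expr2 sqrr_sign mul1r.
Qed.

Lemma output_prob_basis (t : nat) (A : query_alg R s t) (b : s.-tuple bool)
    (e : bool) (x : 'I_(s * qwork A)) :
  qfinal A b = (-1) ^+ e *: delta_mx x 0 -> output_prob A b (x \in qaccept A) = 1.
Proof.
move=> fin; rewrite /output_prob (bigD1 x) //= big1 => [|y /andP[_ /negbTE yx]].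
  by rewrite fin !mxE !eqxx mulr1 normr_sign expr1n addr0.
by rewrite fin !mxE yx mulr0 normr0 expr0n.
Qed.

(* One exact query computes the parity of two bits; the label of the work
   register keeps the two branches orthogonal even if the bits coincide. *)
Lemma two_query_parities (a a' : 'I_s) (i j : bool -> 'I_s) :
  exists A : query_alg R s 2, forall b : s.-tuple bool,
    let c := tnth b a (+) tnth b a' in
    output_prob A b (tnth b (i c) (+) tnth b (j c)) = 1.
Proof.
have [st [st_neq stE]] : exists st : 'I_s -> nat -> 'I_(s * 6),
    (forall x y l l', (l < 6)%N -> (l' < 6)%N -> l != l' -> st x l != st y l') /\
    (forall x l, st x l = mxtens_index (x, inord l)).
  exists (fun x l => mxtens_index (x, inord l)); split => // x y l l' l6 l6' ll.
  apply: contraNneq ll => /(can_inj (@mxtens_indexK _ _)) [_ /(congr1 val)].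
  by rewrite /= !inordK // => ->.
have orc (b : s.-tuple bool) x y l l' (c : R[i]) :
    oracle R 6 b *m (c *: (delta_mx (st x l) 0 + delta_mx (st y l') 0))
    = (-1) ^+ tnth b x *: (c *: (delta_mx (st x l) 0
        + (-1) ^+ (tnth b x (+) tnth b y) *: delta_mx (st y l') 0)) :> 'cV[R[i]]_(s * 6).
  by rewrite !stE oracle_pair.
(* Labels 0 and 1 serve the first query; each outcome [c] has its own pair [de c], [ep c] for the
   second, which makes six labels. *)
pose al := st a 0%N; pose be := st a' 1%N.
pose de c := st (i c) (if c then 3 else 2)%N.
pose ep c := st (j c) (if c then 5 else 4)%N.
pose had x y : 'M[R[i]]_(s * 6) := hadamard _ x y.
pose tr x y : 'M[R[i]]_(s * 6) := perm_mx (tperm x y).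
pose H2 := had (de true) (ep true) *m had (de false) (ep false).
(* [U0] prepares the first query. [U1] decodes its parity [c] as [al] or [be], swaps that state into
   [de c] and spreads it over [de c] and [ep c]. The last gate [H2] yields [ep c] if the second
   parity is 1 and [de c] otherwise. *)
pose U0 := had al be.
pose U1 := H2 *m (tr be (de true) *m (tr al (de false) *m had al be)).
pose U (k : 'I_3) := nth U0 [:: U0; U1; H2] k.
have albe : al != be by exact: st_neq.
have deep c c' : de c != ep c' by case: c; case: c'; exact: st_neq.
have H2u : H2 \is unitarymx by rewrite mul_unitarymx ?hadamard_unitary.
have Uu k : U k \is unitarymx.
  have U1u : U1 \is unitarymx.
    by rewrite !(mul_unitarymx, perm_mx_unitary, hadamard_unitary).
  have U0u : U0 \is unitarymx by exact: hadamard_unitary.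
  by rewrite /U; case: k => -[|[|[|k]]] kP /=; [exact: U0u|exact: U1u|exact: H2u|].
pose A := @QueryAlg R s 2 6 2 (leqnn 2) U Uu al [set ep false; ep true].
exists A => b c; set y := tnth b (i c) (+) tnth b (j c).
pose h : R[i] := (sqrtC 2)^-1.
have dT : de true != de false by exact: st_neq.
have dF : de false != de true by exact: st_neq.
have eT : ep true != ep false by exact: st_neq.
have eF : ep false != ep true by exact: st_neq.
have epde c1 c2 : ep c1 != de c2 by case: c1; case: c2; exact: st_neq.
have H2de : H2 *m delta_mx (de c) 0
    = h *: (delta_mx (de c) 0 + delta_mx (ep c) 0) :> 'cV_(s * 6).
  rewrite /H2 -mulmxA /had; case: (c).
    by rewrite (hadamard_other _ dF (epde _ _)) (hadamard_left _ (deep _ _)).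
  rewrite (hadamard_left _ (deep _ _)) -scalemxAr mulmxDr.
  by rewrite (hadamard_other _ dT (epde _ _)) (hadamard_other _ (deep _ _) eT).
have H2ph : H2 *m (h *: (delta_mx (de c) 0 + (-1) ^+ y *: delta_mx (ep c) 0))
    = delta_mx (if y then ep c else de c) 0 :> 'cV_(s * 6).
  rewrite /H2 -mulmxA /had; case: (c).
    rewrite -(hadamard_phase _ y (deep _ _)); congr (_ *m _).
    rewrite -scalemxAr mulmxDr -scalemxAr (hadamard_other _ dF (epde _ _)).
    by rewrite (hadamard_other _ (deep _ _) eF).
  rewrite (hadamard_phase _ y (deep _ _)); case: (y).
    by rewrite (hadamard_other _ (deep _ _) eT).
  by rewrite (hadamard_other _ dT (epde _ _)).
have trs : tr be (de true) *m (tr al (de false) *m delta_mx (if c then be else al) 0)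
    = delta_mx (de c) 0 :> 'cV_(s * 6).
  rewrite /tr !tperm_mx_delta; case: (c).
    rewrite (@tpermD _ al _ be) ?tpermL //; exact: st_neq.
  rewrite tpermL (@tpermD _ be) //; exact: st_neq.
have U0E : qstate_at A b 0 = h *: (delta_mx al 0 + delta_mx be 0).
  by rewrite /= /U inordK //= /U0 /had (hadamard_left _ albe).
have U1E : U (inord 1) = U1 by rewrite /U inordK.
have U2E : U (inord 2) = H2 by rewrite /U inordK.
clearbody H2 tr.
have st1 : qstate_at A b 1
    = (-1) ^+ tnth b a *: (h *: (delta_mx (de c) 0 + delta_mx (ep c) 0)).
  rewrite -H2de -trs -(hadamard_phase _ c albe) -/h.
  rewrite (_ : qstate_at A b 1 = U (inord 1) *m (oracle R 6 b *m qstate_at A b 0)) //.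
  rewrite U1E U0E orc -/c /U1 /had -!mulmxA.
  by rewrite -!scalemxAr.
have fin : qfinal A b
    = (-1) ^+ (tnth b a (+) tnth b (i c)) *: delta_mx (if y then ep c else de c) 0.
  rewrite (_ : qfinal A b = U (inord 2) *m (oracle R 6 b *m qstate_at A b 1)) //.
  rewrite U2E st1 -scalemxAr orc -/y -2!scalemxAr H2ph.
  by rewrite scalerA -signr_addb.
rewrite (_ : y = ((if y then ep c else de c) \in qaccept A)).
  exact: output_prob_basis fin.
rewrite /= !inE; case: (y).
  by case: (c); rewrite eqxx ?orbT.
by rewrite !(negbTE (deep _ _)).
Qed.

End TwoQueries.

(** * The scheme and its asymptotic length *)

Lemma has_scheme_cells (R : realType) (m n q : nat) :
  (0 < q)%N -> (m <= q ^ 8)%N -> (n <= q)%N ->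
  has_scheme R m n 2 (2049 * q ^ 7).+1.
Proof.
move=> q0 mq nq; pose G := 'I_(q ^ 7); pose V := 'I_(2048 * q ^ 7).
pose L := (bool * bool * 'I_q)%type; pose cell := option (G + V).
have -> : (2049 * q ^ 7).+1 = #|{: cell}|.
  by rewrite card_option card_sum !card_ord -mulSn.
have [h hq] : exists h : {ffun G * L -> V}, lossless h (8 * q).
  by apply: exists_lossless; rewrite ?card_ord ?card_bool2_ord.
have divP (x : 'I_m) : (x %/ q < q ^ 7)%N.
  by rewrite ltn_divLR // -expnSr (leq_trans (ltn_ord x)).
pose grp x : G := Ordinal (divP x).
pose pos (x : 'I_m) : 'I_q := Ordinal (ltn_pmod x q0).
have grp_pos_inj x y : grp x = grp y -> pos x = pos y -> x = y.
  move=> /(congr1 val) /= dxy /(congr1 val) /= mxy; apply: val_inj => /=.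
  by rewrite (divn_eq x q) dxy mxy -divn_eq.
pose val (S : {set 'I_m}) g r := [exists x in S, (grp x == g) && (pos x == r)].
have valE S x : val S (grp x) (pos x) = (x \in S).
  apply/exists_inP/idP => [[y yS /andP[/eqP gy /eqP py]]|xS].
    by rewrite -(grp_pos_inj y x).
  by exists x; rewrite ?eqxx.
(* Guarding by the size of [S] makes the condition satisfiable for every [S], as the choice of a
   total storage map requires. *)
pose P (S : {set 'I_m}) (fg : (V -> bool) * (G -> bool)) := (#|S| <= n)%N ->
  forall g r, fg.1 (h (g, (fg.2 g, false, r))) (+) fg.1 (h (g, (fg.2 g, true, r)))
              = val S g r.
have /boolp.choice[fg fgP] S : exists fg, P S fg.
  have [Sn|Sn] := leqP #|S| n; last first.
    by exists (fun=> false, fun=> false); rewrite /P leqNgt Sn.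
  have [|f [g fgP]] := lossless_store (val := val S) hq; last by exists (f, g).
  apply: leq_trans nq; apply: leq_trans Sn.
  apply: leq_trans (leq_imset_card grp S).
  apply/subset_leq_card/subsetP => g; rewrite inE => /existsP[r].
  by case/exists_inP => x xS /andP[/eqP <- _]; exact: imset_f.
pose cellval S (z : cell) := match z with
  | None => false | Some (inl g) => (fg S).2 g | Some (inr v) => (fg S).1 v end.
pose store S := [tuple cellval S (enum_val i) | i < #|{: cell}|].
have storeE S z : tnth (store S) (enum_rank z) = cellval S z.
  by rewrite tnth_mktuple enum_rankK.
pose loc x c e : 'I_#|{: cell}| := enum_rank (Some (inr (h (grp x, (c, e, pos x))))).
have /boolp.choice[A AP] x := two_query_parities R
  (enum_rank (Some (inl (grp x)) : cell)) (enum_rank (None : cell))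
  (fun c => loc x c false) (fun c => loc x c true).
exists store, A => S x Sn.
have := AP x (store S); rewrite /= !storeE /= addbF.
by rewrite fgP // valE.
Qed.

Lemma ex_min_scheme (R : realType) (m n t s : nat) : has_scheme R m n t s ->
  exists2 s', is_s_QA R m n t s' & (s' <= s)%N.
Proof.
move=> sch; have ex : exists s0, `[< has_scheme R m n t s0 >].
  by exists s; apply/asboolP.
case: (ex_minnP ex) => s' /asboolP sch' min; exists s'; last exact/min/asboolP.
by split=> // s0 /asboolP; exact: min.
Qed.

Local Open Scope classical_set_scope.

Theorem theorem2 (R : realType) :
  exists2 s_QA : nat -> nat,
    (forall m : nat, is_s_QA R m (Num.truncn ((m%:R : R) `^ (1 / 8))) 2 (s_QA m))
    & (fun m : nat => (s_QA m)%:R : R) =O_\oo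
      (fun m : nat => (m%:R : R) `^ (7 / 8)).
Proof.
pose y m : R := (m%:R : R) `^ (1 / 8).
have y0 m : 0 <= y m by exact: powR_ge0.
have yX m j : y m ^+ j = (m%:R : R) `^ (j%:R / 8).
  by rewrite -powR_mulrn // -powRrM mulrC mulrA mulr1.
have y8 m : y m ^+ 8 = m%:R by rewrite yX divff ?pnatr_eq0 // powRr1.
(* [q m] exceeds m^(1/8), whence m <= q^8, and it is at least the bound on the set size. *)
pose q m := (Num.truncn (y m)).+1.
have yq m : (q m).-1%:R <= y m < (q m)%:R by exact: truncn_itv.
have /boolp.choice[s_QA sP] m : exists s, is_s_QA R m (Num.truncn (y m)) 2 s
    /\ (s <= (2049 * q m ^ 7).+1)%N.
  have [|s sP le] := @ex_min_scheme R m (Num.truncn (y m)) 2 (2049 * q m ^ 7).+1;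
    last by exists s.
  apply: has_scheme_cells => //.
  rewrite -(ler_nat R) natrX; case/andP: (yq m) => _ /ltW yq'.
  by rewrite -y8 lerXn2r ?nnegrE.
exists s_QA => [m|]; first by case: (sP m).
apply/eqOP; near=> k; near=> m.
have m0 : (0 < m)%N by near: m; exact: nbhs_infty_gt.
rewrite ger0_norm // ger0_norm ?powR_ge0 // -yX.
have y1 : 1 <= y m.
  by rewrite -(@ler_pXn2r _ 8) ?nnegrE // expr1n y8 ler1n.
have qy : (q m)%:R <= 2 * y m.
  by case/andP: (yq m) => + _; rewrite /q /= -natr1; lra.
have q7 : (q m)%:R ^+ 7 <= 128 * y m ^+ 7.
  rewrite (_ : 128 = 2 ^+ 7) -?exprMn ?lerXn2r ?nnegrE ?mulr_ge0 //.
  by rewrite -natrX.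
case: (sP m) => _; rewrite -(ler_nat R) -natr1 natrM natrX => le.
(* The constant cell adds 1, which is absorbed by raising 2049 to 2050, as [y m] is at least 1. *)
apply: (@le_trans _ _ (2050 * 128 * y m ^+ 7)).
  have : 1 <= y m ^+ 7 by exact: exprn_ege1.
  lra.
by rewrite ler_wpM2r ?exprn_ge0 //; near: k; exact: nbhs_pinfty_ge.
Unshelve. all: by end_near.
Qed.
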